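(* Let $s,t\geq 1$ be integers and let $p,q,l$ be three distinct primes with $p,q$ odd, $p\equiv 3 \pmod 4$, $\mathrm{ord}_{p^s}(l)=\phi(p^s)/2$, $\mathrm{ord}_{q^t}(l)=\phi(q^t)$ and $\gcd(\phi(p^s),\phi(q^t))=2$. Let $0\leq i\leq s-1$ and $0\leq j\leq t-1$. Then in the ring $\mathbb{F}_l[x]/\langle x^{p^sq^t}-1\rangle$: \[\begin{aligned}\chi_{ij}\chi_{ij}^*=&\frac{p-3}{4}p^{s-i-1}(q-2)q^{t-j-1}(\chi_{ij}+\chi_{ij}^* )+\frac{p-3}{4}p^{s-i-1}\phi(q^{t-j})\sum_{j<m\leq t}(\chi_{im}+\chi_{im}^* )\\& +\frac{\phi(p^{s-i})}{2}\phi(q^{t-j})\sum_{\substack{i<k\leq s-1\\ j<m\leq t}}(\chi_{km}+\chi_{km}^* )+\frac{\phi(p^{s-i})}{2}(q-2)q^{t-j-1}\chi_{sj}\\& +\frac{\phi(p^{s-i})}{2}\phi(q^{t-j})\sum_{j<m\leq t}\chi_{sm}+\frac{\phi(p^{s-i})}{2}(q-2)q^{t-j-1}\sum_{i<k\leq s-1}(\chi_{kj}+\chi_{kj}^* ). \end{aligned}\]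
   Context: Here $\phi$ is Euler's phi function (with $\phi(1)=1$) and $\mathrm{ord}_m(k)$ is the multiplicative order of $k$ modulo $m$. Put $n=p^sq^t$. Fix an integer $g$ that is a primitive root both modulo $p^s$ and modulo $q^t$. For an integer $\gamma$, $C_\gamma=\{\gamma l^r \bmod n: r\geq 0\}\subseteq \mathbb{Z}_n$ is the $l$-cyclotomic coset modulo $n$ containing $\gamma$. For $0\leq i\leq s$, $0\leq j\leq t$ set $C_{ij}=C_{p^iq^j}$ and $C_{ij}^*=C_{p^iq^jg}$; in particular $C_{sj}=C_{sj}^*$ and $C_{st}=C_0=\{0\}$. Define elements of $\mathbb{F}_l[x]/\langle x^{n}-1\rangle$ by $\chi_{ij}=\sum_{\alpha\in C_{ij}}x^\alpha$ and $\chi_{ij}^*=\sum_{\alpha\in C_{ij}^*}x^\alpha$; in particular $\chi_{sj}=\chi_{sj}^*$ and $\chi_{st}=1$. Integer coefficients are read in $\mathbb{F}_l$, and empty sums are $0$. *)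

(* Defs.v *)
From HB Require Import structures.
From mathcomp Require Import all_boot all_order all_algebra all_fingroup.
Set Implicit Arguments.
Unset Strict Implicit.
Unset Printing Implicit Defensive.
Import GRing.Theory.
Local Open Scope ring_scope.

(* Meaningful when m > 1 and k is coprime to m; if k is not invertible modulo
   m, the value is the order 1 of the unit 1. *)
Definition mult_order (m : nat) (k : int) : nat :=
  #[insubd (1%g : {unit 'Z_m}) (k%:~R : 'Z_m)]%g.

Definition primitive_root_mod (m : nat) (g : int) : bool :=
  coprimez m g && (mult_order m g == totient m).

Notation cyclic_ring l n := {poly %/ ('X^n - 1 : {poly 'F_l})}.

(* [{poly %/ h}] is the quotient by [mk_monic h], which is [h] here. *)
Fact mk_monic_XnsubC1 (l n : nat) :
  (0 < n)%N -> mk_monic ('X^n - 1 : {poly 'F_l}) = 'X^n - 1.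
Proof.
by move=> n_gt0; rewrite /mk_monic size_XnsubC // ltnS n_gt0 monicXnsubC.
Qed.

(* [fconnect f a b] says that b is an iterate of f at a. *)
Definition cyclotomic_coset (l n : nat) (gamma : int) : {set 'Z_n} :=
  [set a | fconnect (fun b : 'Z_n => b * l%:R) gamma%:~R a].

Fact cyclotomic_cosetP (l n : nat) (gamma : int) (a : 'Z_n) :
  reflect (exists r : nat, a = (gamma * l%:Z ^+ r)%:~R)
          (a \in cyclotomic_coset l n gamma).
Proof.
have iterE r : iter r (fun b : 'Z_n => b * l%:R) gamma%:~R
             = (gamma * l%:Z ^+ r)%:~R.
  elim: r => [|r IHr]; first by rewrite expr0 mulr1.
  by rewrite iterS IHr exprSr mulrA [RHS]rmorphM.
rewrite inE; apply: (iffP idP) => [/iter_findex Ea | [r ->]].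
  by exists (findex (fun b : 'Z_n => b * l%:R) gamma%:~R a); rewrite -iterE Ea.
by rewrite -iterE; apply: fconnect_iter.
Qed.

(* The coset sum of x ^ a, with a ranging over representatives in [0, n). *)
Definition coset_sum (l n : nat) (gamma : int) : cyclic_ring l n :=
  \sum_(a in cyclotomic_coset l n gamma) 'qX ^+ (a : nat).

Definition chi (p q s t l i j : nat) : cyclic_ring l (p ^ s * q ^ t) :=
  coset_sum l (p ^ s * q ^ t) (p ^ i * q ^ j)%N.

Definition chi_star (p q s t l : nat) (g : int) (i j : nat) :
    cyclic_ring l (p ^ s * q ^ t) :=
  coset_sum l (p ^ s * q ^ t) ((p ^ i * q ^ j)%N%:Z * g).

(* Main.v *)
(* Since p = 3 mod 4 and the two totients have gcd 2, the orders of l modulo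
   p ^ s and q ^ t are coprime. Writing the n-th root of unity x as y1 * y2,
   with y1 and y2 of order dividing p ^ s and q ^ t, every coset sum factors
   through the Chinese remainder theorem as a coset sum in y1 times one in y2.
   Let I_k and J_m be the sums of the powers of y1 and y2 over the ideals
   (p ^ k) and (q ^ m). As l generates the units modulo q ^ t, the second
   factor is J_m - J_(m+1), and products of such are immediate. Modulo p ^ s,
   <l> has index 2 and odd order, so it misses -1 and -g is in <l>: the cosets
   of z and z g are opposite, with sum I_k - I_(k+1). Their product is the sum
   of N(c) y1 ^ c, where N(c) counts the pairs of elements of the coset of z
   with difference c. N vanishes off (p ^ k), equals the size of the coset on
   (p ^ (k+1)), and is constant in between because it is invariant under <l>
   and -1; taking y1 = 1 in the ring of integers determines that constant. All
   the sums in the theorem then telescope. *)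

Require Import Defs.
From mathcomp Require Import all_boot all_order all_algebra all_fingroup.
From mathcomp Require Import all_solvable.
From mathcomp Require Import ring zify.
Set Implicit Arguments.
Unset Strict Implicit.
Unset Printing Implicit Defensive.
Import GRing.Theory.
Local Open Scope ring_scope.

(** * Residues modulo [m] and divisibility of their representatives *)

Lemma eqr_Zp_nat m a b : (1 < m)%N ->
  (a%:R == b%:R :> 'Z_m) = (a == b %[mod m])%N.
Proof. by move=> m_gt1; rewrite -val_eqE /= !val_Zp_nat. Qed.

(** A single natural representative serves all divisors of [n] at once: a negative integer is
    shifted by a multiple of [n], which vanishes modulo each of them. *)
Lemma intr_Zp_nat n z : (0 < n)%N -> exists k, forall m,
  (1 < m)%N -> (m %| n)%N -> z%:~R = k%:R :> 'Z_m.
Proof.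
move=> n_gt0; case: z => k; first by exists k.
exists (n * k.+1 - k.+1)%N => m m_gt1 m_n.
have n0 : n%:R = 0 :> 'Z_m by apply/eqP; rewrite -Zp_nat_mod // (eqP m_n).
by rewrite NegzE natrB ?leq_pmull // natrM n0 mul0r sub0r mulrNz.
Qed.

Lemma natr_Zp_dvd m n k : (1 < m)%N -> (1 < n)%N -> (m %| n)%N ->
  ((k%:R : 'Z_n) : nat)%:R = k%:R :> 'Z_m.
Proof.
move=> m_gt1 n_gt1 m_n; apply/eqP.
by rewrite eqr_Zp_nat // val_Zp_nat // modn_dvdm.
Qed.

Lemma intr_Zp_dvd m n z : (1 < m)%N -> (1 < n)%N -> (m %| n)%N ->
  ((z%:~R : 'Z_n) : nat)%:R = z%:~R :> 'Z_m.
Proof.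
move=> m_gt1 n_gt1 m_n; have [k Ek] := intr_Zp_nat z (ltnW n_gt1).
by rewrite !Ek // natr_Zp_dvd.
Qed.

Lemma dvdn_Zp_nat d m a : (1 < m)%N -> (d %| m)%N ->
  (d %| (a%:R : 'Z_m))%N = (d %| a)%N.
Proof. by move=> m_gt1 d_m; rewrite val_Zp_nat // /dvdn modn_dvdm. Qed.

Lemma card_dvdn_Zp d m : (1 < m)%N -> (d %| m)%N ->
  #|[set u : 'Z_m | d %| u]%N| = (m %/ d)%N.
Proof.
move=> m_gt1 d_m; have d_gt0 : (0 < d)%N by apply: dvdn_gt0 d_m; apply: ltnW.
pose f (b : 'I_(m %/ d)) : 'Z_m := (d * b)%:R.
have lt_db (b : 'I_(m %/ d)) : (d * b < m)%N.
  by have := ltn_ord b; rewrite ltn_divRL // mulnC.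
have inj_f : injective f.
  move=> a b /eqP; rewrite eqr_Zp_nat // !modn_small ?lt_db // eqn_pmul2l //.
  by move/eqP/val_inj.
rewrite -[RHS]card_ord -(card_imset _ inj_f); apply: eq_card => u.
rewrite inE; apply/idP/imsetP => [d_u | [b _ ->]].
  have lt_u : (u %/ d < m %/ d)%N.
    rewrite ltn_divLR // divnK //; have := ltn_ord u.
    by rewrite [X in (_ < X)%N]Zp_cast.
  by exists (Ordinal lt_u); rewrite // /f /= mulnC divnK // natr_Zp.
by rewrite dvdn_Zp_nat // dvdn_mulr.
Qed.

Lemma dvdn_ZpD d m (u v : 'Z_m) : (1 < m)%N -> (d %| m)%N ->
  (d %| v)%N -> (d %| (u + v : 'Z_m)%R)%N = (d %| u)%N.
Proof.
move=> m_gt1 d_m d_v.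
by rewrite -[u]natr_Zp -[v]natr_Zp -natrD !dvdn_Zp_nat // dvdn_addl.
Qed.

Lemma dvdn_ZpN d m (u : 'Z_m) : (1 < m)%N -> (d %| m)%N ->
  (d %| (- u : 'Z_m)%R)%N = (d %| u)%N.
Proof.
move=> m_gt1 d_m; have sub (v : 'Z_m) : (d %| v)%N -> (d %| (- v : 'Z_m)%R)%N.
  by move=> d_v; rewrite -(dvdn_ZpD _ m_gt1 d_m d_v) addNr dvdn0.
by apply/idP/idP => /sub; rewrite ?opprK.
Qed.

(** This describes level [k], the residues of exact valuation [k], as an orbit of the unit group.
    The cofactor of p^k is prime to [p], hence a unit. *)
Lemma Zp_pfactorP p s k (a : 'Z_(p ^ s)) : prime p -> (k < s)%N ->
  reflect (exists2 w : 'Z_(p ^ s), w \is a GRing.unit & a = (p ^ k)%:R * w)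
    ((p ^ k %| a)%N && ~~ (p ^ k.+1 %| a)%N).
Proof.
move=> p_pr lt_ks; have m_gt1 : (1 < p ^ s)%N.
  by rewrite -(exp1n s) ltn_exp2r ?prime_gt1 // (leq_trans _ lt_ks).
have s_gt0 : (0 < s)%N by apply: leq_trans lt_ks.
have pk_m : (p ^ k.+1 %| p ^ s)%N by apply: dvdn_exp2l.
have pk_gt0 : (0 < p ^ k)%N by rewrite expn_gt0 prime_gt0.
apply: (iffP andP) => [[pk_a npk_a] | [w]].
  exists (a %/ p ^ k)%:R; last by rewrite -natrM mulnC divnK // natr_Zp.
  rewrite unitZpE // coprimeXl // prime_coprime //.
  by rewrite dvdn_divRL // -expnS.
rewrite -[w]natr_Zp unitZpE // coprime_pexpl // prime_coprime // => np_w ->.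
rewrite -natrM !dvdn_Zp_nat ?dvdn_exp2l ?(ltnW lt_ks) // dvdn_mulr //.
by rewrite expnSr dvdn_pmul2l.
Qed.

(** * Sums of powers of a root of unity over ideals *)

Section Exponentials.

Variables (A : comNzRingType) (m : nat) (y : A).
Hypotheses (m_gt1 : (1 < m)%N) (ym : y ^+ m = 1).

Lemma exprZpD (u v : 'Z_m) : y ^+ (u + v : 'Z_m)%R = y ^+ u * y ^+ v.
Proof.
by rewrite -{1}[u]natr_Zp -{1}[v]natr_Zp -natrD val_Zp_nat // expr_mod // exprD.
Qed.

(** Convolution: the terms of the double product are grouped by c = a + b. *)
Lemma mul_sum_exprZp (S T : {set 'Z_m}) :
  (\sum_(a in S) y ^+ a) * (\sum_(b in T) y ^+ b)
  = \sum_(c : 'Z_m) y ^+ c *+ #|[set a in S | c - a \in T]|.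
Proof.
rewrite big_distrlr /=.
transitivity (\sum_(a in S) \sum_(c | c - a \in T) y ^+ c).
  apply: eq_bigr => a _; rewrite (reindex (fun c => c - a)); last first.
    by exists (fun c => c + a) => c _; rewrite ?addrK ?subrK.
  by apply: eq_bigr => c _; rewrite -exprZpD addrC subrK.
rewrite (exchange_big_dep xpredT) //=; apply: eq_bigr => c _.
rewrite -sumr_const; apply: eq_bigl => a; by rewrite inE.
Qed.

(** When [d] divides [m], the condition on the representative [u] defines the ideal generated by
    [d]. *)
Definition ideal_sum d : A := \sum_(u : 'Z_m | (d %| u)%N) y ^+ u.

Lemma ideal_sum_absorb d (v : 'Z_m) : (d %| m)%N -> (d %| v)%N ->
  ideal_sum d * y ^+ v = ideal_sum d.
Proof.
move=> d_m d_v; rewrite /ideal_sum [RHS](reindex_inj (addIr v)) mulr_suml.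
by apply: eq_big => u; rewrite ?dvdn_ZpD // exprZpD.
Qed.

(** The ideal of [d2] lies in that of [d1], so each of the m/d2 terms of the second sum merely
    translates the first ideal into itself. *)
Lemma ideal_sumM d1 d2 : (d1 %| d2)%N -> (d2 %| m)%N ->
  ideal_sum d1 * ideal_sum d2 = ideal_sum d1 *+ (m %/ d2).
Proof.
move=> d12 d2_m; rewrite {2}/ideal_sum mulr_sumr.
rewrite (eq_bigr (fun _ => ideal_sum d1)) => [|v d2_v]; last first.
  by rewrite ideal_sum_absorb ?(dvdn_trans d12).
rewrite -card_dvdn_Zp // -sumr_const; apply: eq_bigl => u; by rewrite inE.
Qed.

Lemma ideal_sum_full : ideal_sum m = 1.
Proof.
rewrite /ideal_sum (big_pred1 0) // => u /=.
by rewrite -[u in RHS]natr_Zp (eqr_Zp_nat _ 0) // mod0n.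
Qed.

Lemma sum_dvdn_diff d1 d2 : (d1 %| d2)%N ->
  \sum_(u : 'Z_m | (d1 %| u)%N && ~~ (d2 %| u)%N) y ^+ u
  = ideal_sum d1 - ideal_sum d2.
Proof.
move=> d12; apply/eqP; rewrite eq_sym subr_eq; apply/eqP.
rewrite /ideal_sum (bigID (fun u : 'Z_m => d2 %| u)%N) /= addrC; congr (_ + _).
apply: eq_bigl => u; case d2_u: (d2 %| u)%N; rewrite ?andbF //.
by rewrite (dvdn_trans d12).
Qed.

End Exponentials.

(** * Multiplicative order and the subgroup of units generated by an integer *)

Lemma coprimez_unit_Zp m (k : int) : (1 < m)%N -> coprimez m k ->
  (k%:~R : 'Z_m) \is a GRing.unit.
Proof.
move=> m_gt1 /coprimezP[[u v] /= uv1]; apply/unitrP; exists v%:~R.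
suff: v%:~R * k%:~R = 1 :> 'Z_m by rewrite [_ * v%:~R]mulrC.
have /(congr1 (fun z : int => z%:~R : 'Z_m)) := uv1.
by rewrite intrD !intrM -[(Posz m)%:~R]/(m%:R) pchar_Zp // mulr0 add0r.
Qed.

Lemma mult_order_dvd m (k : int) e : (k%:~R : 'Z_m) \is a GRing.unit ->
  (mult_order m k %| e)%N = (k%:~R ^+ e == 1 :> 'Z_m).
Proof.
move=> k_unit; rewrite /mult_order order_dvdn -val_eqE FinRing.val_unitX /=.
by rewrite val_insubd k_unit.
Qed.

Lemma exprZ_mult_order m (k : int) : (k%:~R : 'Z_m) \is a GRing.unit ->
  k%:~R ^+ mult_order m k = 1 :> 'Z_m.
Proof. by move=> k_unit; apply/eqP; rewrite -mult_order_dvd. Qed.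

Lemma expr_mult_orderP m (k : int) (w : 'Z_m) :
  (k%:~R : 'Z_m) \is a GRing.unit -> w \is a GRing.unit ->
  reflect (exists r, w = k%:~R ^+ r)
    (insubd (1%g : {unit 'Z_m}) w
       \in <[insubd (1%g : {unit 'Z_m}) (k%:~R : 'Z_m)]>)%g.
Proof.
move=> k_unit w_unit; apply: (iffP (cycleP _ _)) => [][r Er]; exists r.
  have /(congr1 val) := Er.
  by rewrite FinRing.val_unitX /= !val_insubd k_unit w_unit.
by apply/val_inj; rewrite FinRing.val_unitX /= !val_insubd k_unit w_unit.
Qed.

Lemma expr_generates_units m (k : int) (w : 'Z_m) : (1 < m)%N ->
  (k%:~R : 'Z_m) \is a GRing.unit -> mult_order m k = totient m ->
  w \is a GRing.unit -> exists r, w = k%:~R ^+ r.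
Proof.
move=> m_gt1 k_unit ord_k w_unit; apply/(expr_mult_orderP k_unit w_unit).
suff -> : <[insubd (1%g : {unit 'Z_m}) (k%:~R : 'Z_m)]>%g = setT by rewrite inE.
apply/eqP; rewrite eqEcard subsetT /=.
by rewrite (card_units_Zp (ltnW m_gt1)) -ord_k /mult_order.
Qed.

(** A group of odd order does not contain -1, so the powers of [k] and their negatives are disjoint;
    by cardinality they exhaust the units. *)
Lemma expr_half_units m (k : int) (w : 'Z_m) : (2 < m)%N ->
  (k%:~R : 'Z_m) \is a GRing.unit -> odd (mult_order m k) ->
  (mult_order m k).*2 = totient m ->
  w \is a GRing.unit -> exists r, w = k%:~R ^+ r \/ w = - k%:~R ^+ r.
Proof.
move=> m_gt2 k_unit odd_k ord_k w_unit; have m_gt1 := ltnW m_gt2.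
set x := insubd (1%g : {unit 'Z_m}) (k%:~R : 'Z_m).
have valN1 : val (insubd (1%g : {unit 'Z_m}) (- 1 : 'Z_m)) = -1.
  by rewrite val_insubd unitrN1.
set N1 := insubd _ _ in valN1.
have N1_notin : N1 \notin <[x]>%g.
  apply/negP => /cycleP[r /(congr1 val)].
  rewrite valN1 FinRing.val_unitX val_insubd k_unit.
  (* Raising -1 = k^r to the odd order of [k] gives -1 = 1, impossible for m > 2. *)
  move/(congr1 (fun a => a ^+ mult_order m k)).
  rewrite -exprM mulnC exprM exprZ_mult_order // expr1n -signr_odd odd_k expr1.
  move/esym/eqP; rewrite -addr_eq0 -(natrD _ 1 1) (eqr_Zp_nat _ 0) //.
  by rewrite mod0n modn_small.
have units_split : (<[x]> :|: <[x]> :* N1)%g = setT.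
  apply/eqP; rewrite eqEcard subsetT /= cardsU card_rcoset.
  have -> : (<[x]> :&: <[x]> :* N1)%g = set0.
    apply/setP => a; rewrite !inE; apply/andP => [][ax].
    rewrite mem_rcoset => /(groupM (groupVr ax)).
    by rewrite mulKg groupV (negPf N1_notin).
  rewrite cards0 subn0 addnn -[#|_|]/(mult_order m k) ord_k.
  by rewrite (card_units_Zp (ltnW m_gt1)).
have := in_setT (insubd (1%g : {unit 'Z_m}) w); rewrite -units_split !inE.
case/orP => [/(expr_mult_orderP k_unit w_unit)[r ->]|]; first by exists r; left.
rewrite mem_rcoset => /cycleP[r Er]; exists r; right.
have /(congr1 val) : insubd (1%g : {unit 'Z_m}) w = (x ^+ r * N1)%g.
  by rewrite -Er mulgKV.
rewrite FinRing.val_unitM FinRing.val_unitX valN1 !val_insubd k_unit w_unit.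
by rewrite mulrN1.
Qed.


(** * Cyclotomic cosets under the Chinese remainder theorem *)

Lemma coset_Zp_P l m (z : int) (a : 'Z_m) :
  reflect (exists r, a = z%:~R * l%:R ^+ r) (a \in cyclotomic_coset l m z).
Proof.
by apply: (iffP (cyclotomic_cosetP l z a)) => [][r ->]; exists r;
  rewrite intrM rmorphXn.
Qed.

Section ChineseRemainder.

Variables (l m1 m2 : nat).
Hypotheses (m1_gt1 : (1 < m1)%N) (m2_gt1 : (1 < m2)%N) (co_m : coprime m1 m2).

Let n_gt1 : (1 < m1 * m2)%N.
Proof. by rewrite (leq_trans m1_gt1) // leq_pmulr // ltnW. Qed.

Let m1_n : (m1 %| m1 * m2)%N. Proof. exact: dvdn_mulr. Qed.
Let m2_n : (m2 %| m1 * m2)%N. Proof. exact: dvdn_mull. Qed.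

Let crt (a : 'Z_(m1 * m2)) : 'Z_m1 * 'Z_m2 := ((a : nat)%:R, (a : nat)%:R).

Let crt_inj : injective crt.
Proof.
move=> a b [/eqP + /eqP]; rewrite !eqr_Zp_nat // => ab1 ab2.
rewrite -[a]natr_Zp -[b]natr_Zp; apply/eqP.
by rewrite eqr_Zp_nat // chinese_remainder // ab1.
Qed.

(** The two components may use different exponents of [l]. As the orders of [l] are coprime, one
    exponent congruent to each of them modulo the respective order replaces both. *)
Lemma mem_coset_crt (z : int) (a : 'Z_(m1 * m2)) :
  (l%:R : 'Z_m1) \is a GRing.unit -> (l%:R : 'Z_m2) \is a GRing.unit ->
  coprime (mult_order m1 l) (mult_order m2 l) ->
  (a \in cyclotomic_coset l (m1 * m2) z)
  = ((a : nat)%:R \in cyclotomic_coset l m1 z)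
    && ((a : nat)%:R \in cyclotomic_coset l m2 z).
Proof.
move=> l1 l2 co_ord; set d1 := mult_order m1 l; set d2 := mult_order m2 l.
apply/idP/andP => [/cyclotomic_cosetP[r ->] | ].
  by split; apply/cyclotomic_cosetP; exists r;
    rewrite intr_Zp_dvd.
move=> [/coset_Zp_P[r1 a1] /coset_Zp_P[r2 a2]].
apply/cyclotomic_cosetP; exists (chinese d1 d2 r1 r2); apply: crt_inj.
rewrite /crt !intr_Zp_dvd //.
rewrite a1 a2 !intrM !rmorphXn /=; congr (_ * _, _ * _).
  have e : l%:R ^+ d1 = 1 :> 'Z_m1 by apply: (@exprZ_mult_order _ l).
  by rewrite -(expr_mod _ e) -(chinese_modl co_ord r1 r2) expr_mod.
have e : l%:R ^+ d2 = 1 :> 'Z_m2 by apply: (@exprZ_mult_order _ l).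
by rewrite -(expr_mod _ e) -(chinese_modr co_ord r1 r2) expr_mod.
Qed.

Lemma sum_coset_crt (A : comNzRingType) (y1 y2 : A) (z : int) :
  y1 ^+ m1 = 1 -> y2 ^+ m2 = 1 ->
  (l%:R : 'Z_m1) \is a GRing.unit -> (l%:R : 'Z_m2) \is a GRing.unit ->
  coprime (mult_order m1 l) (mult_order m2 l) ->
  \sum_(a in cyclotomic_coset l (m1 * m2) z) (y1 * y2) ^+ (a : nat)
  = (\sum_(a in cyclotomic_coset l m1 z) y1 ^+ (a : nat))
    * (\sum_(a in cyclotomic_coset l m2 z) y2 ^+ (a : nat)).
Proof.
move=> y1m y2m l1 l2 co_ord; rewrite big_distrlr pair_big /=.
have [crt' crtK crt'K] : bijective crt.
  by apply: inj_card_bij crt_inj _; rewrite card_prod !card_ord !Zp_cast.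
rewrite (reindex crt) /=; last by exists crt' => ? _.
apply: eq_big => a; first exact: mem_coset_crt.
by rewrite !val_Zp_nat // !expr_mod // exprMn.
Qed.

End ChineseRemainder.

(** The exponents are the Chinese idempotents (1,0) and (0,1), whose sum is 1 modulo m1 m2. *)
Lemma root_of_unity_split (A : comNzRingType) (x : A) m1 m2 :
  coprime m1 m2 -> x ^+ (m1 * m2) = 1 ->
  exists y1 y2 : A, [/\ y1 ^+ m1 = 1, y2 ^+ m2 = 1 & x = y1 * y2].
Proof.
move=> co_m xn; exists (x ^+ chinese m1 m2 1 0), (x ^+ chinese m1 m2 0 1).
have xE k : (k = 1 %[mod m1 * m2])%N -> x ^+ k = x.
  by move=> k1; rewrite -(expr_mod k xn) k1 expr_mod.
have x1 k : (m1 * m2 %| k)%N -> x ^+ k = 1.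
  by case/dvdnP=> c ->; rewrite mulnC exprM xn expr1n.
split; last first; rewrite -?exprM -?exprD.
- rewrite xE //; apply/eqP; rewrite chinese_remainder //; apply/andP.
  split; apply/eqP; rewrite -modnDm.
    by rewrite !chinese_modl // modnDm.
  by rewrite !chinese_modr // modnDm.
- by rewrite x1 // dvdn_mul // /dvdn chinese_modl // mod0n.
by rewrite x1 // mulnC dvdn_mul // /dvdn chinese_modr // mod0n.
Qed.

(** Expressing the three truncated differences through one [e] brings the exponents into a form for
    polynomial arithmetic. *)
Lemma subn_gapE k s : (k < s)%N ->
  exists e, [/\ s - k - 1 = e, s - k.+1 = e & s - k = e.+1]%N.
Proof. by move=> lt_ks; exists (s - k - 1)%N; split; lia. Qed.

Lemma sum_coset0 (A : comNzRingType) (y : A) l m (z : int) :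
  z%:~R = 0 :> 'Z_m ->
  \sum_(a in cyclotomic_coset l m z) y ^+ (a : nat) = 1.
Proof.
move=> z0; rewrite (big_pred1 0) // => a /=.
apply/coset_Zp_P/eqP => [[r ->] | ->]; first by rewrite z0 mul0r.
by exists 0%N; rewrite z0 mul0r.
Qed.

(** * Cosets modulo a prime power *)

Section PrimePower.

Variables (p s l : nat).
Hypotheses (p_pr : prime p) (s_gt0 : (0 < s)%N).
Local Notation m := (p ^ s)%N.
Local Notation L := (l%:R : 'Z_m).
Hypothesis L_unit : L \is a GRing.unit.

Let m_gt1 : (1 < m)%N.
Proof. by rewrite -(exp1n s) ltn_exp2r ?prime_gt1. Qed.

(** When [l] generates the units, the coset of p^k u is p^k times all units, that is, the whole
    level [k]. *)
Lemma mem_coset_generator k (z : int) (u a : 'Z_m) :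
    (forall w : 'Z_m, w \is a GRing.unit -> exists r, w = L ^+ r) ->
    (k < s)%N -> u \is a GRing.unit -> z%:~R = (p ^ k)%:R * u ->
  (a \in cyclotomic_coset l m z) = (p ^ k %| a)%N && ~~ (p ^ k.+1 %| a)%N.
Proof.
move=> L_gen lt_ks u_unit zE.
apply/coset_Zp_P/(Zp_pfactorP a p_pr lt_ks) => [[r ->] | [w w_unit ->]].
  by exists (u * L ^+ r); rewrite ?unitrM ?unitrX ?u_unit // zE mulrA.
have [r Er] : exists r, w / u = L ^+ r.
  by apply: L_gen; rewrite unitrM w_unit unitrV.
by exists r; rewrite zE -Er mulrCA -mulrA mulrCA mulrV // mulr1.
Qed.

(** The relation l^d = 1 descends from p^s to [p]. If l^r = -l^r' modulo [p], the odd power [d] of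
    both sides gives 1 = -1, against p > 2. *)
Lemma expr_add_neq0_modp r r' : odd p -> odd (mult_order m l) ->
  ~~ (p %| l ^ r + l ^ r')%N.
Proof.
move=> p_odd d_odd; apply/negP => p_dv; set d := mult_order m l in d_odd.
have p_gt1 := prime_gt1 p_pr.
have Ld : (l%:R : 'Z_p) ^+ d = 1.
  have /eqP : L ^+ d = 1 by apply: (@exprZ_mult_order _ l).
  rewrite -natrX (eqr_Zp_nat _ 1) // => /eqP Ld; apply/eqP.
  rewrite -natrX (eqr_Zp_nat _ 1) // -(modn_dvdm _ (dvdn_exp s_gt0 (dvdnn p))).
  by rewrite Ld modn_dvdm // dvdn_exp.
have : (l%:R : 'Z_p) ^+ r = - l%:R ^+ r'.
  apply/eqP; rewrite -addr_eq0 -!natrX -natrD (eqr_Zp_nat _ 0) //.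
  by rewrite mod0n.
move/(congr1 (fun a => a ^+ d)).
rewrite exprNn -!exprM ![(_ * d)%N]mulnC !exprM Ld.
rewrite !expr1n mulr1 -signr_odd d_odd expr1.
move/eqP; rewrite -addr_eq0 -(natrD _ 1 1) (eqr_Zp_nat _ 0) //.
by rewrite mod0n modn_small // odd_prime_gt2.
Qed.

End PrimePower.

(** * The case where [l] has odd order and index 2 modulo p^s *)

Section HalfOrder.

Variables (p s l : nat) (g : int).
Hypotheses (p_pr : prime p) (p_odd : odd p) (s_gt0 : (0 < s)%N).
Local Notation m := (p ^ s)%N.
Local Notation L := (l%:R : 'Z_m).
Hypothesis L_unit : L \is a GRing.unit.
Hypotheses (d_odd : odd (mult_order m l))
           (ord_L : (mult_order m l).*2 = totient m)
           (g_root : primitive_root_mod m g).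

Let m_gt1 : (1 < m)%N.
Proof. by rewrite -(exp1n s) ltn_exp2r ?prime_gt1. Qed.

Let m_gt2 : (2 < m)%N.
Proof.
rewrite ltn_neqAle m_gt1 andbT; apply/eqP => m2.
by have := oddX p s; rewrite -m2 p_odd orbT.
Qed.

Let L_half (w : 'Z_m) : w \is a GRing.unit ->
  exists r, w = L ^+ r \/ w = - L ^+ r.
Proof. exact: (@expr_half_units _ l). Qed.

Let Ld : L ^+ mult_order m l = 1.
Proof. exact: (@exprZ_mult_order _ l). Qed.

(** Either [g] or -g is a power of [l]. The former would make the order of [g], which is the full
    totient, divide the order of [l], which is half of it. *)
Lemma oppr_primitive_root : exists r, - g%:~R = L ^+ r.
Proof.
have /andP[co_g /eqP ord_g] := g_root.
have g_unit := coprimez_unit_Zp m_gt1 co_g.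
have [r [gE | gE]] := L_half g_unit; last by exists r; rewrite gE opprK.
have : (mult_order m g %| mult_order m l)%N.
  by rewrite mult_order_dvd // gE -exprM mulnC exprM Ld expr1n.
have d_gt0 : (0 < mult_order m l)%N by case: (mult_order m l) d_odd.
rewrite ord_g -ord_L => /(dvdn_leq d_gt0).
by rewrite leqNgt -addnn -[X in (X < _)%N]addn0 ltn_add2l d_gt0.
Qed.

Lemma mem_coset_primitive_root (z : int) (a : 'Z_m) :
  (a \in cyclotomic_coset l m (z * g)) = (- a \in cyclotomic_coset l m z).
Proof.
have [r0 Er0] := oppr_primitive_root.
have gE : g%:~R = - L ^+ r0 by rewrite -Er0 opprK.
apply/coset_Zp_P/coset_Zp_P => [[r ->] | [r Ea]].
  by exists (r0 + r)%N; rewrite intrM gE exprD; ring.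
(* The first summand is a natural exponent for the inverse of l^r0, where g = -l^r0. *)
exists (r0 * (mult_order m l).-1 + r)%N.
have Linv : L ^+ r0 * L ^+ (r0 * (mult_order m l).-1) = 1.
  rewrite -exprD -mulnS prednK; last by case: (mult_order m l) d_odd.
  by rewrite mulnC exprM Ld expr1n.
rewrite -[a]opprK Ea intrM gE exprD -mulrA mulNr mulrN.
by rewrite [L ^+ r0 * _]mulrA Linv mul1r.
Qed.

(** * Cosets at a fixed level [k], and the count of their differences *)

Section Level.

Variables (k : nat) (z : int) (u : 'Z_m).
Hypotheses (lt_ks : (k < s)%N) (u_unit : u \is a GRing.unit)
           (zE : z%:~R = (p ^ k)%:R * u).

Local Notation C := (cyclotomic_coset l m z).

Lemma coset_sub_level (a : 'Z_m) : a \in C ->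
  (p ^ k %| a)%N && ~~ (p ^ k.+1 %| a)%N.
Proof.
case/coset_Zp_P=> r ->; apply/(Zp_pfactorP _ p_pr lt_ks).
by exists (u * L ^+ r); rewrite ?unitrM ?unitrX ?u_unit // zE mulrA.
Qed.

Lemma level_split (a : 'Z_m) :
  (p ^ k %| a)%N && ~~ (p ^ k.+1 %| a)%N -> (a \in C) || (- a \in C).
Proof.
case/(Zp_pfactorP _ p_pr lt_ks) => w w_unit ->.
have [r Er] : exists r, w / u = L ^+ r \/ w / u = - L ^+ r.
  by apply: L_half; rewrite unitrM w_unit unitrV.
have wE : (p ^ k)%:R * w = z%:~R * (w / u).
  by rewrite zE mulrCA -mulrA mulrCA mulrV // mulr1.
rewrite wE; case: Er => ->; apply/orP; [left | right].
  by apply/coset_Zp_P; exists r.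
by apply/coset_Zp_P; exists r; rewrite mulrN opprK.
Qed.

(** The sum is p^k u (l^r + l^r'), and the last factor is a unit because the order of [l] is odd. *)
Lemma add_coset_ndvdn (a b : 'Z_m) : a \in C -> b \in C ->
  ~~ (p ^ k.+1 %| (a + b : 'Z_m)%R)%N.
Proof.
case/coset_Zp_P=> r -> /coset_Zp_P[r' ->]; rewrite -mulrDr zE -mulrA.
suff w_unit : L ^+ r + L ^+ r' \is a GRing.unit.
  have /(Zp_pfactorP _ p_pr lt_ks)/andP[//] :
    exists2 w : 'Z_m, w \is a GRing.unit
      & (p ^ k)%:R * (u * (L ^+ r + L ^+ r')) = (p ^ k)%:R * w.
  by exists (u * (L ^+ r + L ^+ r')); rewrite // unitrM u_unit.
rewrite -!natrX -natrD unitZpE // coprime_pexpl // prime_coprime //.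
exact: (@expr_add_neq0_modp _ s).
Qed.

Lemma cosetN_disjoint (a : 'Z_m) : a \in C -> - a \notin C.
Proof.
by move=> aC; apply/negP => /(add_coset_ndvdn aC); rewrite subrr dvdn0.
Qed.

(** The element a - c is still of level [k], so it or its negative is in [C]. If c - a were, its sum
    with [a] would be [c], which p^(k+1) divides. *)
Lemma mem_coset_sub (a c : 'Z_m) : (p ^ k.+1 %| c)%N -> a \in C -> a - c \in C.
Proof.
move=> c_dv aC; have pk_m : (p ^ k.+1 %| m)%N by rewrite dvdn_exp2l.
have pk_pk1 : (p ^ k %| p ^ k.+1)%N by rewrite dvdn_exp2l.
have pk'_m := dvdn_trans pk_pk1 pk_m.
have Nc_dv : (p ^ k.+1 %| (- c : 'Z_m)%R)%N.
  by rewrite dvdn_ZpN.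
have /level_split/orP[//|] : (p ^ k %| (a - c : 'Z_m)%R)%N
    && ~~ (p ^ k.+1 %| (a - c : 'Z_m)%R)%N.
  by rewrite !dvdn_ZpD // ?coset_sub_level // (dvdn_trans pk_pk1).
by move=> /(add_coset_ndvdn aC); rewrite opprB addrC subrK c_dv.
Qed.

Lemma mem_coset_mulX (a : 'Z_m) r : (a * L ^+ r \in C) = (a \in C).
Proof.
have mulX b r' : b \in C -> b * L ^+ r' \in C.
  case/coset_Zp_P=> r1 ->; apply/coset_Zp_P.
  by exists (r1 + r')%N; rewrite exprD mulrA.
apply/idP/idP => [/(mulX _ (r * (mult_order m l).-1)%N) | /mulX //].
rewrite -mulrA -exprD -mulnS prednK; last by case: (mult_order m l) d_odd.
by rewrite mulnC exprM Ld expr1n mulr1.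
Qed.

(** The number of pairs of elements of [C] with difference [c]. *)
Let N (c : 'Z_m) := #|[set a in C | a - c \in C]|.

Let N_mulX c r : N (c * L ^+ r) = N c.
Proof.
have inj : injective (fun a : 'Z_m => a * L ^+ r).
  by apply: mulIr; rewrite unitrX.
rewrite /N -(card_imset [set a in C | a - c \in C] inj); apply: eq_card => a.
rewrite inE; apply/andP/imsetP => [[aC acC] | [b]]; last first.
  by rewrite inE => /andP[bC bcC] ->; rewrite -mulrBl !mem_coset_mulX.
have aE : a = a / L ^+ r * L ^+ r by rewrite divrK ?unitrX.
exists (a / L ^+ r) => //; rewrite inE -(mem_coset_mulX _ r) -aE aC.
by rewrite -(mem_coset_mulX _ r) mulrBl -aE.
Qed.

Let N_opp c : N (- c) = N c.
Proof.
rewrite /N -(card_imset [set a in C | a - c \in C] (addIr (- c))).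
apply: eq_card => a; rewrite inE opprK.
apply/andP/imsetP => [[aC acC] | [b]]; last first.
  by rewrite inE => /andP[bC bcC] ->; rewrite subrK.
by exists (a + c); rewrite ?addrK // inE acC addrK.
Qed.

(** Level [k] consists of [C] and -C, and the count is invariant under powers of [l] and under
    negation. *)
Let N_level (c c' : 'Z_m) : (p ^ k %| c)%N && ~~ (p ^ k.+1 %| c)%N ->
  (p ^ k %| c')%N && ~~ (p ^ k.+1 %| c')%N -> N c = N c'.
Proof.
have N_z a : a \in C -> N a = N z%:~R by case/coset_Zp_P=> r ->.
have N_z' (a : 'Z_m) : (p ^ k %| a)%N && ~~ (p ^ k.+1 %| a)%N -> N a = N z%:~R.
  by case/level_split/orP=> /N_z //; rewrite N_opp.
by move=> /N_z' -> /N_z' ->.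
Qed.

Let N_high (c : 'Z_m) : (p ^ k.+1 %| c)%N -> N c = #|C|.
Proof.
move=> c_dv; apply: eq_card => a; rewrite inE andb_idr // => aC.
exact: mem_coset_sub.
Qed.

Let N_low (c : 'Z_m) : ~~ (p ^ k %| c)%N -> N c = 0%N.
Proof.
move=> c_ndv; apply: eq_card0 => a; rewrite inE; apply/negP => /andP[aC acC].
case/negP: c_ndv; have pk_m : (p ^ k %| m)%N by rewrite dvdn_exp2l // ltnW.
have /andP[a_dv _] := coset_sub_level aC.
have /andP[ac_dv _] := coset_sub_level acC.
by rewrite -[c](subKr a) dvdn_ZpD // dvdn_ZpN.
Qed.

Section Sums.

Variables (A : comNzRingType) (y : A).
Hypothesis ym : y ^+ m = 1.

Local Notation I k := (ideal_sum m y (p ^ k)).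
Local Notation S z := (\sum_(a in cyclotomic_coset l m z) y ^+ (a : nat)).

(** The second coset is -C, which is disjoint from [C] and completes it to level [k]. *)
Lemma sum_coset_pair : S z + S (z * g) = I k - I k.+1.
Proof.
rewrite -sum_dvdn_diff ?dvdn_exp2l // [RHS](bigID (mem C)) /=; congr (_ + _).
  by apply: eq_bigl => a; rewrite andb_idl //; apply: coset_sub_level.
apply: eq_bigl => a; rewrite mem_coset_primitive_root.
have pk_m : (p ^ k %| m)%N by rewrite dvdn_exp2l // ltnW.
have pk1_m : (p ^ k.+1 %| m)%N by rewrite dvdn_exp2l.
apply/idP/andP => [aC | [/level_split/orP[aC | //] /negP//]].
rewrite -[a]opprK cosetN_disjoint // opprK.
by rewrite -(dvdn_ZpN a) // -[(_ ^ k.+1 %| a)%N]dvdn_ZpN // coset_sub_level.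
Qed.

Lemma sum_coset_mul_counts : S z * S (z * g)
  = (I k - I k.+1) *+ N z%:~R + I k.+1 *+ #|C|.
Proof.
rewrite mul_sum_exprZp //.
(* Since c - a lies in -C exactly when a - c lies in [C], the convolution counts differences within
   [C]. *)
transitivity (\sum_(c : 'Z_m) y ^+ c *+ N c).
  apply: eq_bigr => c _; congr (_ *+ #|pred_of_set _|).
  by apply: eq_finset => a; rewrite mem_coset_primitive_root opprB.
rewrite (bigID (fun c : 'Z_m => p ^ k.+1 %| c)%N) /= addrC.
congr (_ + _); last first.
  by rewrite -sumrMnl; apply: eq_bigr => c /N_high ->.
rewrite -sum_dvdn_diff ?dvdn_exp2l // (bigID (fun c : 'Z_m => p ^ k %| c)%N) /=.
rewrite [X in _ + X]big1 => [|c /andP[_ /N_low ->]]; last by rewrite mulr0n.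
rewrite addr0 -sumrMnl; apply: eq_big => c; first by rewrite andbC.
rewrite andbC => c_lv; congr (_ *+ _); apply: N_level => //.
apply: coset_sub_level; apply/coset_Zp_P.
by exists 0%N; rewrite mulr1.
Qed.

End Sums.

Lemma card_coset_primitive_root : #|cyclotomic_coset l m (z * g)| = #|C|.
Proof.
rewrite -(card_imset (mem C) (@oppr_inj 'Z_m)); apply: eq_card => a.
rewrite mem_coset_primitive_root; apply/idP/imsetP => [aC | [b bC ->]].
  by exists (- a); rewrite ?opprK.
by rewrite opprK.
Qed.

Let ideal_sum1 j : (j <= s)%N ->
  ideal_sum m (1 : int) (p ^ j) = (p ^ (s - j))%:R.
Proof.
move=> le_js; rewrite /ideal_sum (eq_bigr (fun=> 1)) => [|v _]; last first.
  exact: expr1n.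
rewrite sumr_const; congr (_ *+ _).
by rewrite -[LHS]cardsE card_dvdn_Zp ?dvdn_exp2l // -expnB ?prime_gt0.
Qed.

Let sum1 (D : {set 'Z_m}) : \sum_(a in D) (1 : int) ^+ (a : nat) = #|D|%:R.
Proof. by rewrite -sumr_const; apply: eq_bigr => a _; rewrite expr1n. Qed.

Lemma card_coset_half : (2 * #|C| = (p - 1) * p ^ (s - k - 1))%N.
Proof.
have := sum_coset_pair (1 : int).
rewrite !sum1 card_coset_primitive_root !ideal_sum1 ?(ltnW lt_ks) //.
have [e0 [-> -> ->]] := subn_gapE lt_ks.
rewrite expnS.
set e := (p ^ _)%N; have := prime_gt0 p_pr; nia.
Qed.

(** Put y = 1 in the integers and e = p^(s-k-1). The product formula becomes |C|^2 = 2|C| N + e|C|,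
    whence |C| = 2N + e, and 2|C| = (p-1)e. *)
Lemma card_difference_level : (4 * N z%:~R = (p - 3) * p ^ (s - k - 1))%N.
Proof.
have := sum_coset_mul_counts (expr1n _ _ : (1 : int) ^+ m = 1).
rewrite !sum1 card_coset_primitive_root !ideal_sum1 ?(ltnW lt_ks) //.
have := card_coset_half; set n0 := N _; set c := #|C|.
have [e0 [-> -> ->]] := subn_gapE lt_ks.
rewrite expnS.
set e := (p ^ _)%N => cE sqE.
have e_gt0 : (0 < e)%N by rewrite expn_gt0 prime_gt0.
have p_gt2 : (2 < p)%N by apply: odd_prime_gt2.
have c_gt0 : (0 < c)%N by nia.
have : (c * c = c * (2 * n0 + e))%N by nia.
move/eqP; rewrite eqn_pmul2l // => /eqP cE'; nia.
Qed.

Lemma sum_coset_mul (A : comNzRingType) (y : A) :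
    y ^+ m = 1 -> p = 3 %[mod 4] ->
  (\sum_(a in C) y ^+ (a : nat))
    * (\sum_(a in cyclotomic_coset l m (z * g)) y ^+ (a : nat))
  = (ideal_sum m y (p ^ k) - ideal_sum m y (p ^ k.+1))
      *+ ((p - 3) %/ 4 * p ^ (s - k - 1))
    + ideal_sum m y (p ^ k.+1) *+ (totient (p ^ (s - k)) %/ 2).
Proof.
move=> ym p_mod4; rewrite sum_coset_mul_counts //; congr (_ *+ _ + _ *+ _).
  (* As p = 3 modulo 4, the division of p - 3 by 4 is exact. *)
  have p3E : (p - 3 = 4 * (p %/ 4))%N by move: p_mod4; clear; lia.
  have := card_difference_level; rewrite p3E mulKn // -mulnA => /eqP.
  by rewrite eqn_pmul2l // => /eqP.
rewrite totient_pfactor ?subn_gt0 // -subn1 -[(s - k).-1]subn1 -card_coset_half.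
by rewrite mulKn.
Qed.

End Level.
End HalfOrder.

(** * The product formula for the composite modulus *)

Lemma qpolyX_root_of_unity l n : (0 < n)%N -> ('qX : cyclic_ring l n) ^+ n = 1.
Proof.
move=> n_gt0; rewrite /qpolyX -rmorphXn /=; apply/eqP.
rewrite -subr_eq0 -(rmorph1 (in_qpoly _)) -rmorphB /=.
apply/eqP/val_inj => /=; rewrite mk_monic_XnsubC1 //.
by apply: polydiv.Pdiv.RingMonic.rmodpp; apply: monicXnsubC.
Qed.

(** The identity is proved for any [x] with x^n = 1 in a commutative ring, with coefficients as
    natural multiples; this frees it from the quotient ring and its scalars. *)
Lemma sum_coset_mul_crt (A : comNzRingType) (x : A)
  (s t p q l : nat) (g : int) (i j : nat)
  (s_ge1 : (1 <= s)%N) (t_ge1 : (1 <= t)%N)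
  (p_prime : prime p) (q_prime : prime q) (l_prime : prime l)
  (pq_distinct : p != q) (pl_distinct : p != l) (ql_distinct : q != l)
  (p_odd : odd p) (q_odd : odd q)
  (p_mod4 : (p = 3 %[mod 4])%N)
  (ord_ps : mult_order (p ^ s) l%:Z = (totient (p ^ s) %/ 2)%N)
  (ord_qt : mult_order (q ^ t) l%:Z = totient (q ^ t))
  (gcd_phi : gcdn (totient (p ^ s)) (totient (q ^ t)) = 2%N)
  (g_ps : primitive_root_mod (p ^ s) g) (g_qt : primitive_root_mod (q ^ t) g)
  (i_le : (i <= s - 1)%N) (j_le : (j <= t - 1)%N) 
  (xn : x ^+ (p ^ s * q ^ t) = 1) :
  let S z := \sum_(a in cyclotomic_coset l (p ^ s * q ^ t) z) x ^+ (a : nat) in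
  let X i j := S (p ^ i * q ^ j)%N%:Z in
  let X' i j := S ((p ^ i * q ^ j)%N%:Z * g) in
  X i j * X' i j =
    (X i j + X' i j)
      *+ ((p - 3) %/ 4 * p ^ (s - i - 1) * ((q - 2) * q ^ (t - j - 1)))
  + (\sum_(j.+1 <= m < t.+1) (X i m + X' i m))
      *+ ((p - 3) %/ 4 * p ^ (s - i - 1) * totient (q ^ (t - j)))
  + (\sum_(i.+1 <= k < s) \sum_(j.+1 <= m < t.+1) (X k m + X' k m))
      *+ (totient (p ^ (s - i)) %/ 2 * totient (q ^ (t - j)))
  + X s j *+ (totient (p ^ (s - i)) %/ 2 * ((q - 2) * q ^ (t - j - 1)))
  + (\sum_(j.+1 <= m < t.+1) X s m)
      *+ (totient (p ^ (s - i)) %/ 2 * totient (q ^ (t - j)))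
  + (\sum_(i.+1 <= k < s) (X k j + X' k j))
      *+ (totient (p ^ (s - i)) %/ 2 * ((q - 2) * q ^ (t - j - 1))).
Proof.
have lt_is : (i < s)%N by rewrite -(prednK s_ge1) ltnS -subn1.
have lt_jt : (j < t)%N by rewrite -(prednK t_ge1) ltnS -subn1.
have gt1 r e : prime r -> (0 < e)%N -> (1 < r ^ e)%N.
  by move=> r_pr e_gt0; rewrite -(exp1n e) ltn_exp2r ?prime_gt1.
have m1_gt1 := gt1 p s p_prime s_ge1; have m2_gt1 := gt1 q t q_prime t_ge1.
have co_pq : coprime p q by rewrite prime_coprime // dvdn_prime2.
have co_m : coprime (p ^ s) (q ^ t) by rewrite coprimeXl // coprimeXr.
have L1 : (l%:R : 'Z_(p ^ s)) \is a GRing.unit.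
  by rewrite unitZpE // coprimeXl // prime_coprime // dvdn_prime2.
have L2 : (l%:R : 'Z_(q ^ t)) \is a GRing.unit.
  by rewrite unitZpE // coprimeXl // prime_coprime // dvdn_prime2.
(* For p = 3 modulo 4, (p-1)/2 is the odd number 2 (p %/ 4) + 1; this makes the order of [l] modulo
   p^s odd. *)
have p1E : (totient (p ^ s) = 2 * ((p %/ 4 * 2 + 1) * p ^ s.-1))%N.
  rewrite totient_pfactor // mulnA; congr (_ * _)%N.
  by move: p_mod4; clear; lia.
have ord_pE : mult_order (p ^ s) l = ((p %/ 4 * 2 + 1) * p ^ s.-1)%N.
  by rewrite ord_ps p1E mulKn.
have d_odd : odd (mult_order (p ^ s) l).
  by rewrite ord_pE oddM oddX p_odd orbT addn1 /= oddM andbF.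
have ord_p2 : (mult_order (p ^ s) l).*2 = totient (p ^ s).
  by rewrite ord_pE p1E mul2n.
have co_ord : coprime (mult_order (p ^ s) l) (mult_order (q ^ t) l).
  (* The orders divide the totients, so their gcd divides 2; it is odd, hence 1. *)
  have : (gcdn (mult_order (p ^ s) l) (mult_order (q ^ t) l) %| 2)%N.
    rewrite -gcd_phi dvdn_gcd -ord_p2 -mul2n ord_qt dvdn_gcdr andbT.
    by rewrite dvdn_mull // dvdn_gcdl.
  have /primeP[_ /[apply]] : prime 2 by [].
  case/orP=> // /eqP gcd2.
  have := dvdn_gcdl (mult_order (p ^ s) l) (mult_order (q ^ t) l).
  by rewrite gcd2 dvdn2 d_odd.
have [y1 [y2 [y1n y2n xE]]] := root_of_unity_split co_m xn.
have /andP[g_co2 _] := g_qt.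
have g2 := coprimez_unit_Zp m2_gt1 g_co2.
have L2_gen (w : 'Z_(q ^ t)) : w \is a GRing.unit -> exists r, w = l%:R ^+ r.
  by apply: (@expr_generates_units _ l).
have uq m : ((q ^ m)%:R : 'Z_(p ^ s)) \is a GRing.unit.
  by rewrite unitZpE // coprimeXl // coprimeXr.
have up k : ((p ^ k)%:R : 'Z_(q ^ t)) \is a GRing.unit.
  by rewrite unitZpE // coprimeXl // coprimeXr // coprime_sym.
move=> S X X'.
pose S1 z := \sum_(a in cyclotomic_coset l (p ^ s) z) y1 ^+ (a : nat).
pose S2 z := \sum_(a in cyclotomic_coset l (q ^ t) z) y2 ^+ (a : nat).
have SE z : S z = S1 z * S2 z by rewrite /S xE sum_coset_crt.
pose I k := ideal_sum (p ^ s) y1 (p ^ k).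
(* At q^(t+1), [ideal_sum] would still contain the term of 0. The cutoff makes J_t - J_(t+1) = 1,
   the sum over the zero coset, so level [t] follows the general formula. *)
pose J m := if (m <= t)%N then ideal_sum (q ^ t) y2 (q ^ m) else 0.
have S2E m z (u : 'Z_(q ^ t)) : (m <= t)%N -> u \is a GRing.unit ->
    z%:~R = (q ^ m)%:R * u -> S2 z = J m - J m.+1.
  move=> le_mt u_unit zE; rewrite /J le_mt; case: ltnP => [lt_mt | le_tm].
    rewrite -sum_dvdn_diff ?dvdn_exp2l //; apply: eq_bigl => a.
    exact: (mem_coset_generator q_prime L2 a L2_gen lt_mt u_unit zE).
  have mt : m = t by apply/eqP; rewrite eqn_leq le_mt.
  rewrite subr0 mt ideal_sum_full // /S2 sum_coset0 //.
  by rewrite zE mt pchar_Zp // mul0r.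
have Q k m : (m <= t)%N -> S2 (p ^ k * q ^ m)%N%:Z = J m - J m.+1.
  move=> le_mt; apply: (S2E m _ (p ^ k)%:R) => //.
  by rewrite mulnC -natrM.
have Q' k m : (m <= t)%N -> S2 ((p ^ k * q ^ m)%N%:Z * g) = J m - J m.+1.
  move=> le_mt; apply: (S2E m _ ((p ^ k)%:R * g%:~R)) => //.
    by rewrite unitrM up.
  by rewrite intrM mulrA -natrM [(q ^ m * _)%N]mulnC.
have P k m : (k < s)%N -> S1 (p ^ k * q ^ m)%N%:Z
    + S1 ((p ^ k * q ^ m)%N%:Z * g) = I k - I k.+1.
  move=> lt_ks; apply: (sum_coset_pair p_prime p_odd s_ge1 L1 d_odd ord_p2 g_ps
    lt_ks (uq m)) => //.
  by rewrite -natrM.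
have Ps m : S1 (p ^ s * q ^ m)%N%:Z = I s.
  rewrite /I ideal_sum_full // /S1 sum_coset0 //.
  by rewrite -[LHS]/((p ^ s * q ^ m)%:R) natrM pchar_Zp // mul0r.
have PP : S1 (p ^ i * q ^ j)%N%:Z * S1 ((p ^ i * q ^ j)%N%:Z * g)
  = (I i - I i.+1) *+ ((p - 3) %/ 4 * p ^ (s - i - 1))
    + I i.+1 *+ (totient (p ^ (s - i)) %/ 2).
  apply: (sum_coset_mul p_prime p_odd s_ge1 L1 d_odd ord_p2 g_ps
    lt_is (uq j)) => //.
  by rewrite -natrM.
have QQ : (J j - J j.+1) * (J j - J j.+1)
  = (J j - J j.+1) *+ ((q - 2) * q ^ (t - j - 1))
    + J j.+1 *+ totient (q ^ (t - j)).
  rewrite /J lt_jt (ltnW lt_jt) mulrBl !mulrBr [X in _ - (X - _)]mulrC.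
  rewrite !ideal_sumM ?dvdn_exp2l ?(ltnW lt_jt) //.
  rewrite -!expnB ?prime_gt0 ?(ltnW lt_jt) //.
  have [e [-> -> ->]] := subn_gapE lt_jt.
  rewrite totient_pfactor //= expnS.
  (* Truncated subtractions are removed so that [ring] applies. *)
  have [w [-> -> ->]] : exists w, [/\ q - 2 = w, q.-1 = w + 1 & q = w + 2]%N.
    by exists (q - 2)%N; move: (prime_gt1 q_prime); clear; split; lia.
  move: (ideal_sum _ _ _) (ideal_sum _ _ _) (_ ^ e)%N => b a c; ring.
(* The sum telescopes down to J_(t+1) = 0; its analogue for I stops at I_s, since level [s] enters
   the theorem separately. *)
have sumJ : \sum_(j.+1 <= m < t.+1) (J m - J m.+1) = J j.+1.
  rewrite -[LHS]opprK -sumrN (eq_bigr (fun m => J m.+1 - J m)) => [|m _].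
  2: by rewrite opprB.
  by rewrite telescope_sumr 1?ltnW // /J ltnn sub0r opprK.
have sumI : \sum_(i.+1 <= k < s) (I k - I k.+1) = I i.+1 - I s.
  rewrite -[LHS]opprK -sumrN (eq_bigr (fun m => I m.+1 - I m)) => [|m _].
  2: by rewrite opprB.
  by rewrite telescope_sumr // opprB.
have XE k m : (k < s)%N -> (m <= t)%N ->
    X k m + X' k m = (I k - I k.+1) * (J m - J m.+1).
  by move=> lt_ks le_mt; rewrite /X /X' !SE Q // Q' // -mulrDl P.
have XsE m : (m <= t)%N -> X s m = I s * (J m - J m.+1).
  by move=> le_mt; rewrite /X SE Q // Ps.
rewrite XE ?(ltnW lt_jt) // XsE ?(ltnW lt_jt) //.
have -> : \sum_(j.+1 <= m < t.+1) (X i m + X' i m) = (I i - I i.+1) * J j.+1.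
  rewrite -sumJ mulr_sumr; apply: eq_big_nat => m /andP[_ le_mt]; exact: XE.
have -> : \sum_(j.+1 <= m < t.+1) X s m = I s * J j.+1.
  rewrite -sumJ mulr_sumr; apply: eq_big_nat => m /andP[_ le_mt]; exact: XsE.
have -> : \sum_(i.+1 <= k < s) (X k j + X' k j)
  = (I i.+1 - I s) * (J j - J j.+1).
  rewrite -sumI mulr_suml; apply: eq_big_nat => k /andP[_ lt_ks].
  by apply: XE => //; apply: ltnW.
have -> : \sum_(i.+1 <= k < s) \sum_(j.+1 <= m < t.+1) (X k m + X' k m)
  = (I i.+1 - I s) * J j.+1.
  rewrite -sumI mulr_suml; apply: eq_big_nat => k /andP[_ lt_ks].
  rewrite -sumJ mulr_sumr; apply: eq_big_nat => m /andP[_ le_mt]; exact: XE.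
rewrite /X /X' !SE Q ?(ltnW lt_jt) // Q' ?(ltnW lt_jt) // mulrACA PP QQ.
(* What remains is a polynomial identity in these five sums and four coefficients, in which I_s
   cancels. *)
move: (I i) (I i.+1) (I s) (J j) (J j.+1) => a1 a2 a3 b1 b2.
move: (_ * p ^ _)%N (_ %/ 2)%N (_ * q ^ _)%N (totient (q ^ _)) => c1 c2 c3 c4.
ring.
Qed.

Theorem theorem4p3 (s t p q l : nat) (g : int) (i j : nat)
  (s_ge1 : (1 <= s)%N) (t_ge1 : (1 <= t)%N)
  (p_prime : prime p) (q_prime : prime q) (l_prime : prime l)
  (pq_distinct : p != q) (pl_distinct : p != l) (ql_distinct : q != l)
  (p_odd : odd p) (q_odd : odd q)
  (p_mod4 : (p = 3 %[mod 4])%N)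
  (ord_ps : mult_order (p ^ s) l%:Z = (totient (p ^ s) %/ 2)%N)
  (ord_qt : mult_order (q ^ t) l%:Z = totient (q ^ t))
  (gcd_phi : gcdn (totient (p ^ s)) (totient (q ^ t)) = 2%N)
  (g_ps : primitive_root_mod (p ^ s) g) (g_qt : primitive_root_mod (q ^ t) g)
  (i_le : (i <= s - 1)%N) (j_le : (j <= t - 1)%N) :
  let X := chi p q s t l in
  let X' := chi_star p q s t l g in
  X i j * X' i j =
    ((p - 3) %/ 4 * p ^ (s - i - 1) * ((q - 2) * q ^ (t - j - 1)))%N%:R
        *: (X i j + X' i j)
  + ((p - 3) %/ 4 * p ^ (s - i - 1) * totient (q ^ (t - j)))%N%:R
        *: (\sum_(j.+1 <= m < t.+1) (X i m + X' i m))
  + (totient (p ^ (s - i)) %/ 2 * totient (q ^ (t - j)))%N%:R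
        *: (\sum_(i.+1 <= k < s) \sum_(j.+1 <= m < t.+1) (X k m + X' k m))
  + (totient (p ^ (s - i)) %/ 2 * ((q - 2) * q ^ (t - j - 1)))%N%:R
        *: X s j
  + (totient (p ^ (s - i)) %/ 2 * totient (q ^ (t - j)))%N%:R
        *: (\sum_(j.+1 <= m < t.+1) X s m)
  + (totient (p ^ (s - i)) %/ 2 * ((q - 2) * q ^ (t - j - 1)))%N%:R
        *: (\sum_(i.+1 <= k < s) (X k j + X' k j)).
Proof.
(* Scaling by the image of a natural number in the field is taking that multiple. *)
move=> X X'; rewrite !scaler_nat.
apply: (sum_coset_mul_crt (x := 'qX)) => //.
by rewrite qpolyX_root_of_unity // muln_gt0 !expn_gt0 !prime_gt0.
Qed.
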